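(* Let $\mathbf{C}$ be a topos. Let $X \to L \leftarrow Y$, $X \to S \leftarrow Y$, $X \to L' \leftarrow Y$ and $Y \to R \leftarrow Z$, $Y \to T \leftarrow Z$, $Y \to R' \leftarrow Z$ be cospans in $\mathbf{C}$, and let $$L \leftarrow S' \to S,\qquad S \leftarrow S'' \to L',\qquad R \leftarrow T' \to T,\qquad T \leftarrow T'' \to R'$$ be spans of cospans all of whose legs are monic. Then there is a canonical isomorphism $$(S' \times_S S'') +_Y (T' \times_T T'') \;\cong\; (S' +_Y T') \times_{S +_Y T} (S'' +_Y T'')$$ of spans of cospans from $L +_Y R$ to $L' +_Y R'$. (Canonical means: it is the map into the pullback induced by the maps $(S' \times_S S'') +_Y (T' \times_T T'') \to S'+_Y T'$ and $(S' \times_S S'') +_Y (T' \times_T T'') \to S''+_Y T''$ that are induced on pushouts by the pullback projections.)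
   Context: Topos means elementary topos. $U +_V W$ denotes the pushout of $U \leftarrow V \to W$, and $U \times_V W$ the pullback of $U \to V \leftarrow W$. Given cospans $X \to L \leftarrow Y$ and $X \to S \leftarrow Y$, a span of cospans from $L$ to $S$ is an object $S'$ with maps $X \to S' \leftarrow Y$ and maps (its legs) $L \leftarrow S' \to S$ such that both legs commute with the maps from $X$ and from $Y$. A morphism from a span of cospans $S'_1$ to a span of cospans $S'_2$ (both from $L$ to $S$) is a $\mathbf{C}$-morphism $S'_1\to S'_2$ commuting with the maps from $X$ and $Y$ and with the legs to $L$ and $S$; it is an isomorphism if the underlying $\mathbf{C}$-morphism is. Vertical composition: the composite of $L \leftarrow S' \to S$ and $S \leftarrow S'' \to L'$ is $L \leftarrow S' \times_S S'' \to L'$, with legs the projections followed by $S' \to L$, $S'' \to L'$, and with the induced maps from $X$ and $Y$. Horizontal composition: the composite of $L \leftarrow S' \to S$ (between cospans from $X$ to $Y$) and $R \leftarrow T' \to T$ (between cospans from $Y$ to $Z$) is $L +_Y R \leftarrow S' +_Y T' \to S +_Y T$ with the induced legs and the maps $X \to S' \to S' +_Y T'$, $Z \to T' \to S' +_Y T'$, regarded as a span of cospans between the cospans $L+_Y R$ and $S+_Y T$ from $X$ to $Z$. The left-hand object in the theorem carries the span-of-cospans structure obtained by composing vertically and then horizontally; the right-hand object carries the one obtained by composing horizontally and then vertically. *)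

(* Defs.v *)
Set Implicit Arguments.
Unset Strict Implicit.

Declare Scope cat_scope.
Delimit Scope cat_scope with cat.
Local Open Scope cat_scope.

Record Category : Type := MkCategory {
  Ob :> Type;
  Hom : Ob -> Ob -> Type;
  idm : forall A : Ob, Hom A A;
  comp : forall A B D : Ob, Hom B D -> Hom A B -> Hom A D;
  comp_id_l : forall (A B : Ob) (f : Hom A B), comp (idm B) f = f;
  comp_id_r : forall (A B : Ob) (f : Hom A B), comp f (idm A) = f;
  comp_assoc : forall (A B D E : Ob) (h : Hom D E) (g : Hom B D) (f : Hom A B),
    comp h (comp g f) = comp (comp h g) f
}.

Arguments Hom {_} _ _.
Arguments idm {_} _.
Arguments comp {_ A B D} _ _.

Notation "g ∘ f" := (comp g f) (at level 40, left associativity) : cat_scope.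

Definition Monic (C : Category) (A B : C) (m : Hom A B) : Prop :=
  forall (W : C) (f g : Hom W A), m ∘ f = m ∘ g -> f = g.

Definition IsIso (C : Category) (A B : C) (f : Hom A B) : Prop :=
  exists g : Hom B A, g ∘ f = idm A /\ f ∘ g = idm B.

Definition IsTerminal (C : Category) (T : C) : Prop :=
  forall W : C, exists! u : Hom W T, True.

Definition IsProduct (C : Category) (A B P : C) (p : Hom P A) (q : Hom P B) : Prop :=
  forall (W : C) (h : Hom W A) (k : Hom W B),
    exists! u : Hom W P, p ∘ u = h /\ q ∘ u = k.

(* The universal properties of pullbacks and pushouts are structures in [Type],
   so that the maps they induce can be named; where only the property matters,
   [inhabited] is used. *)

Record IsPullback (C : Category) (U V W : C) (f : Hom U V) (g : Hom W V)
    (P : C) (p : Hom P U) (q : Hom P W) : Type := MkIsPullback {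
  pb_comm : f ∘ p = g ∘ q;
  pb_lift : forall (D : C) (h : Hom D U) (k : Hom D W), f ∘ h = g ∘ k -> Hom D P;
  pb_lift_fst : forall (D : C) (h : Hom D U) (k : Hom D W) (e : f ∘ h = g ∘ k),
    p ∘ pb_lift e = h;
  pb_lift_snd : forall (D : C) (h : Hom D U) (k : Hom D W) (e : f ∘ h = g ∘ k),
    q ∘ pb_lift e = k;
  pb_unique : forall (D : C) (u v : Hom D P),
    p ∘ u = p ∘ v -> q ∘ u = q ∘ v -> u = v
}.

Record Pullback (C : Category) (U V W : C) (f : Hom U V) (g : Hom W V) : Type :=
  MkPullback {
    pb_obj :> C;
    pb_fst : Hom pb_obj U;
    pb_snd : Hom pb_obj W;
    pb_universal : IsPullback f g pb_fst pb_snd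
  }.

Record IsPushout (C : Category) (U V W : C) (f : Hom V U) (g : Hom V W)
    (P : C) (i : Hom U P) (j : Hom W P) : Type := MkIsPushout {
  po_comm : i ∘ f = j ∘ g;
  po_desc : forall (D : C) (h : Hom U D) (k : Hom W D), h ∘ f = k ∘ g -> Hom P D;
  po_desc_inl : forall (D : C) (h : Hom U D) (k : Hom W D) (e : h ∘ f = k ∘ g),
    po_desc e ∘ i = h;
  po_desc_inr : forall (D : C) (h : Hom U D) (k : Hom W D) (e : h ∘ f = k ∘ g),
    po_desc e ∘ j = k;
  po_unique : forall (D : C) (u v : Hom P D),
    u ∘ i = v ∘ i -> u ∘ j = v ∘ j -> u = v
}.

Record Pushout (C : Category) (U V W : C) (f : Hom V U) (g : Hom V W) : Type :=
  MkPushout {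
    po_obj :> C;
    po_inl : Hom U po_obj;
    po_inr : Hom W po_obj;
    po_universal : IsPushout f g po_inl po_inr
  }.

(* In the exponential transpose below, [u] is the map [g × A] between the two
   products. *)

Definition IsExponential (C : Category) (A B E P : C)
    (p : Hom P E) (q : Hom P A) (ev : Hom P B) : Prop :=
  IsProduct p q /\
  forall (W Q : C) (p' : Hom Q W) (q' : Hom Q A), IsProduct p' q' ->
  forall f : Hom Q B,
    exists! g : Hom W E,
      exists u : Hom Q P, p ∘ u = g ∘ p' /\ q ∘ u = q' /\ ev ∘ u = f.

Definition IsSubobjectClassifier (C : Category) (one Omega : C)
    (tr : Hom one Omega) : Prop :=
  IsTerminal one /\
  forall (U A : C) (m : Hom U A), Monic m ->
    exists! chi : Hom A Omega,
      exists t : Hom U one, inhabited (IsPullback chi tr m t).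

(* Elementary topos: finite limits (a terminal object and pullbacks),
   exponentials and a subobject classifier. *)

Record IsTopos (C : Category) : Prop := MkIsTopos {
  topos_terminal : exists one : C, IsTerminal one;
  topos_pullbacks : forall (U V W : C) (f : Hom U V) (g : Hom W V),
    inhabited (Pullback f g);
  topos_exponentials : forall A B : C,
    exists (E P : C) (p : Hom P E) (q : Hom P A) (ev : Hom P B),
      IsExponential p q ev;
  topos_classifier : exists (one Omega : C) (tr : Hom one Omega),
    IsSubobjectClassifier tr
}.

Record Cospan (C : Category) (X Y : C) : Type := MkCospan {
  apex :> C;
  csl : Hom X apex;
  csr : Hom Y apex
}.

Record CospanHom (C : Category) (X Y : C) (A B : Cospan X Y) : Type := MkCospanHom {
  ch_map :> Hom A B;
  ch_csl : ch_map ∘ csl A = csl B;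
  ch_csr : ch_map ∘ csr A = csr B
}.

Record SpanOfCospans (C : Category) (X Y : C) (L S : Cospan X Y) : Type :=
  MkSpanOfCospans {
    mid :> Cospan X Y;
    legl : CospanHom mid L;
    legr : CospanHom mid S
  }.

Definition MonicLegs (C : Category) (X Y : C) (L S : Cospan X Y)
    (s : SpanOfCospans L S) : Prop :=
  Monic (legl s) /\ Monic (legr s).

Record SpanHom (C : Category) (X Y : C) (L S : Cospan X Y)
    (s1 s2 : SpanOfCospans L S) : Type := MkSpanHom {
  sh_map :> CospanHom s1 s2;
  sh_legl : legl s2 ∘ sh_map = legl s1;
  sh_legr : legr s2 ∘ sh_map = legr s1
}.

Definition comp_ch (C : Category) (X Y : C) (A B D : Cospan X Y)
    (g : CospanHom B D) (f : CospanHom A B) : CospanHom A D.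
Proof.
refine (@MkCospanHom _ _ _ A D (g ∘ f) _ _).
- now rewrite <- comp_assoc, ch_csl, ch_csl.
- now rewrite <- comp_assoc, ch_csr, ch_csr.
Defined.

Section Vertical.

Context (C : Category) (X Y : C) (L S L' : Cospan X Y)
  (s : SpanOfCospans L S) (s' : SpanOfCospans S L')
  (P : Pullback (legr s) (legl s')).

Lemma vcomp_csl_comm : legr s ∘ csl s = legl s' ∘ csl s'.
Proof. now rewrite !ch_csl. Qed.

Lemma vcomp_csr_comm : legr s ∘ csr s = legl s' ∘ csr s'.
Proof. now rewrite !ch_csr. Qed.

Definition vcomp_mid : Cospan X Y :=
  @MkCospan _ X Y P
    (pb_lift (pb_universal P) vcomp_csl_comm)
    (pb_lift (pb_universal P) vcomp_csr_comm).

Definition vcomp_fst : CospanHom vcomp_mid s :=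
  @MkCospanHom _ _ _ vcomp_mid s (pb_fst P)
    (pb_lift_fst (pb_universal P) vcomp_csl_comm)
    (pb_lift_fst (pb_universal P) vcomp_csr_comm).

Definition vcomp_snd : CospanHom vcomp_mid s' :=
  @MkCospanHom _ _ _ vcomp_mid s' (pb_snd P)
    (pb_lift_snd (pb_universal P) vcomp_csl_comm)
    (pb_lift_snd (pb_universal P) vcomp_csr_comm).

Definition vcomp : SpanOfCospans L L' :=
  MkSpanOfCospans (comp_ch (legl s) vcomp_fst) (comp_ch (legr s') vcomp_snd).

End Vertical.

Definition hcomp_cospan (C : Category) (X Y Z : C)
    (A : Cospan X Y) (B : Cospan Y Z) (P : Pushout (csr A) (csl B)) : Cospan X Z :=
  @MkCospan _ X Z P (po_inl P ∘ csl A) (po_inr P ∘ csr B).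

Section HorizontalHom.

Context (C : Category) (X Y Z : C)
  (A1 A2 : Cospan X Y) (B1 B2 : Cospan Y Z)
  (f : CospanHom A1 A2) (g : CospanHom B1 B2)
  (P1 : Pushout (csr A1) (csl B1)) (P2 : Pushout (csr A2) (csl B2)).

Lemma hcomp_hom_comm :
  (po_inl P2 ∘ f) ∘ csr A1 = (po_inr P2 ∘ g) ∘ csl B1.
Proof.
rewrite <- !comp_assoc, ch_csr, ch_csl; exact (po_comm (po_universal P2)).
Qed.

Definition hcomp_hom : CospanHom (hcomp_cospan P1) (hcomp_cospan P2).
Proof.
refine (@MkCospanHom _ _ _ (hcomp_cospan P1) (hcomp_cospan P2)
  (po_desc (po_universal P1) hcomp_hom_comm) _ _); simpl.
- now rewrite comp_assoc, po_desc_inl, <- comp_assoc, ch_csl.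
- now rewrite comp_assoc, po_desc_inr, <- comp_assoc, ch_csr.
Defined.

End HorizontalHom.

Definition hcomp (C : Category) (X Y Z : C)
    (L S : Cospan X Y) (R T : Cospan Y Z)
    (s : SpanOfCospans L S) (t : SpanOfCospans R T)
    (PLR : Pushout (csr L) (csl R)) (PST : Pushout (csr S) (csl T))
    (P : Pushout (csr s) (csl t)) :
    SpanOfCospans (hcomp_cospan PLR) (hcomp_cospan PST) :=
  @MkSpanOfCospans _ _ _ _ _ (hcomp_cospan P)
    (hcomp_hom (legl s) (legl t) P PLR)
    (hcomp_hom (legr s) (legr t) P PST).

(* Main.v *)
From Stdlib Require Import Setoid.
Require Import Defs.
Local Open Scope cat_scope.

Set Implicit Arguments.
Unset Strict Implicit.

(** A subobject of a pushout [P = S +_Y T] is the same as a pair of subobjects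
    of [S] and [T] with the same inverse image in [Y], because both are
    classified by maps to [Ω].  Hence a subobject [Q] of [P] through which [Y]
    factors is itself the pushout of its inverse images in [S] and [T]: to
    define a map [Q -> D], glue the graphs of the two given maps to a subobject
    of [P × D], which is the pushout of [S × D] and [T × D] since [- × D] has a
    right adjoint.  Conversely [S' +_Y T'] is the subobject of [S +_Y T] with
    inverse images [S'] and [T'], so the intersection of [S' +_Y T'] and
    [S'' +_Y T''] has inverse images [S' ∩ S''] and [T' ∩ T''], and is therefore
    their pushout over [Y]. *)

(* Unlike [IsPushout], this is a proposition, so it can be derived from the
   existence statements in [IsTopos] without a choice principle. *)
Definition PushoutSquare (C : Category) (Y S T : C) (f : Hom Y S) (g : Hom Y T)
    (P : C) (i : Hom S P) (j : Hom T P) : Prop :=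
  i ∘ f = j ∘ g /\
  forall (D : C) (h : Hom S D) (k : Hom T D), h ∘ f = k ∘ g ->
    exists! u : Hom P D, u ∘ i = h /\ u ∘ j = k.

(** Membership of the generalised element [w] in the subobject [m]. Comparing subobjects by their
    generalised elements lets the arguments below run as in sets. *)
Definition Factors (C : Category) (U A W : C) (m : Hom U A) (w : Hom W A) : Prop :=
  exists u : Hom W U, m ∘ u = w.

(** * Monics, finite limits and pushouts *)

Section Basics.

Context (C : Category).

Lemma monic_comp (A B D : C) (n : Hom B D) (m : Hom A B) :
  Monic n -> Monic m -> Monic (n ∘ m).
Proof.
intros Hn Hm W x y e; apply Hm, Hn; now rewrite !comp_assoc.
Qed.

Lemma factors_comp (U A V W : C) (m : Hom U A) (w : Hom W A) (v : Hom V W) :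
  Factors m w -> Factors m (w ∘ v).
Proof.
intros [u <-]; exists (u ∘ v); apply comp_assoc.
Qed.

Lemma factors_self (U A : C) (m : Hom U A) : Factors m m.
Proof. exists (idm U); apply comp_id_r. Qed.

(** The diagonal of the pullback square represents the intersection of the two subobjects. *)
Lemma monic_pullback_diagonal (A1 A2 A : C) (a1 : Hom A1 A) (a2 : Hom A2 A)
    (P : Pullback a1 a2) : Monic a1 -> Monic a2 -> Monic (a1 ∘ pb_fst P).
Proof.
intros Ha1 Ha2; apply monic_comp; trivial.
intros W x y e; apply (pb_unique (pb_universal P)); trivial.
apply Ha2; rewrite !comp_assoc, <- (pb_comm (pb_universal P)), <- !comp_assoc.
congruence.
Qed.

Lemma factors_pullback_diagonal (A1 A2 A W : C) (a1 : Hom A1 A) (a2 : Hom A2 A)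
    (P : Pullback a1 a2) (w : Hom W A) :
  Factors (a1 ∘ pb_fst P) w <-> Factors a1 w /\ Factors a2 w.
Proof.
split.
- intros [x <-]; split.
  + exists (pb_fst P ∘ x); apply comp_assoc.
  + exists (pb_snd P ∘ x); rewrite comp_assoc.
    now rewrite <- (pb_comm (pb_universal P)).
- intros [[x1 e1] [x2 e2]].
  assert (e : a1 ∘ x1 = a2 ∘ x2) by congruence.
  exists (pb_lift (pb_universal P) e); now rewrite <- comp_assoc, pb_lift_fst.
Qed.

Lemma terminal_unique (one W : C) (u v : Hom W one) : IsTerminal one -> u = v.
Proof.
intros H; destruct (H W) as [t [_ Ht]]; now rewrite <- (Ht u I), <- (Ht v I).
Qed.

Lemma product_pair (A B P W : C) (p : Hom P A) (q : Hom P B)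
    (h : Hom W A) (k : Hom W B) :
  IsProduct p q -> exists u : Hom W P, p ∘ u = h /\ q ∘ u = k.
Proof.
intros H; destruct (H W h k) as [u [Hu _]]; now exists u.
Qed.

Lemma product_ext (A B P W : C) (p : Hom P A) (q : Hom P B) (u v : Hom W P) :
  IsProduct p q -> p ∘ u = p ∘ v -> q ∘ u = q ∘ v -> u = v.
Proof.
intros H e1 e2; destruct (H W (p ∘ v) (q ∘ v)) as [w [_ Hw]].
rewrite <- (Hw u (conj e1 e2)); now apply Hw.
Qed.

Lemma pushout_square (Y S T : C) (f : Hom Y S) (g : Hom Y T) (P : Pushout f g) :
  PushoutSquare f g (po_inl P) (po_inr P).
Proof.
split; [exact (po_comm (po_universal P)) |].
intros D h k e; exists (po_desc (po_universal P) e); split.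
- split; [apply po_desc_inl | apply po_desc_inr].
- intros u [e1 e2]; apply (po_unique (po_universal P)).
  + now rewrite po_desc_inl.
  + now rewrite po_desc_inr.
Qed.

Lemma pushout_ext (Y S T P D : C) (f : Hom Y S) (g : Hom Y T)
    (i : Hom S P) (j : Hom T P) (u v : Hom P D) :
  PushoutSquare f g i j -> u ∘ i = v ∘ i -> u ∘ j = v ∘ j -> u = v.
Proof.
intros [c H] e1 e2.
destruct (H D (v ∘ i) (v ∘ j)) as [w [_ Hw]].
- now rewrite <- !comp_assoc, c.
- rewrite <- (Hw u (conj e1 e2)); now apply Hw.
Qed.

Lemma pushout_comparison (Y S T P Q : C) (f : Hom Y S) (g : Hom Y T)
    (i : Hom S P) (j : Hom T P) (i' : Hom S Q) (j' : Hom T Q) (u : Hom P Q) :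
  PushoutSquare f g i j -> PushoutSquare f g i' j' ->
  u ∘ i = i' -> u ∘ j = j' -> IsIso u.
Proof.
intros HP HQ ei ej.
destruct (proj2 HQ P i j (proj1 HP)) as [v [[vi vj] _]].
exists v; split.
- apply (pushout_ext HP); rewrite <- comp_assoc, comp_id_l; congruence.
- apply (pushout_ext HQ); rewrite <- comp_assoc, comp_id_l; congruence.
Qed.

Lemma topos_product (topC : IsTopos C) (A B : C) :
  exists (P : C) (p : Hom P A) (q : Hom P B), IsProduct p q.
Proof.
destruct (topos_terminal topC) as [one H1].
destruct (H1 A) as [tA _], (H1 B) as [tB _].
destruct (topos_pullbacks topC tA tB) as [PB].
exists PB, (pb_fst PB), (pb_snd PB); intros W h k.
assert (e : tA ∘ h = tB ∘ k) by now apply terminal_unique.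
exists (pb_lift (pb_universal PB) e); split.
- split; [apply pb_lift_fst | apply pb_lift_snd].
- intros v [e1 e2]; apply (pb_unique (pb_universal PB)).
  + now rewrite pb_lift_fst.
  + now rewrite pb_lift_snd.
Qed.

(** The equalizer is the pullback of the graphs of [u] and [v]. Both graphs have first component the
    identity, so the two pullback projections coincide. *)
Lemma topos_equalizer (topC : IsTopos C) (A B : C) (u v : Hom A B) :
  exists (E : C) (e : Hom E A), Monic e /\ u ∘ e = v ∘ e /\
    forall (W : C) (w : Hom W A), u ∘ w = v ∘ w -> Factors e w.
Proof.
destruct (topos_product topC A B) as (AB & p & q & Hpq).
destruct (product_pair (idm A) u Hpq) as [gu [pu qu]].
destruct (product_pair (idm A) v Hpq) as [gv [pv qv]].
destruct (topos_pullbacks topC gu gv) as [E].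
assert (c := pb_comm (pb_universal E)).
assert (cp : pb_fst E = pb_snd E).
{ rewrite <- (comp_id_l (pb_fst E)), <- (comp_id_l (pb_snd E)).
  rewrite <- pu at 1; rewrite <- pv, <- !comp_assoc; now rewrite c. }
exists E, (pb_fst E); repeat split.
- intros W x y e; apply (pb_unique (pb_universal E)); trivial.
  now rewrite <- cp.
- rewrite cp at 2; rewrite <- qu, <- qv, <- !comp_assoc; now rewrite c.
- intros W w e.
  assert (e' : gu ∘ w = gv ∘ w).
  { apply (product_ext Hpq); rewrite !comp_assoc; congruence. }
  exists (pb_lift (pb_universal E) e'); apply pb_lift_fst.
Qed.

End Basics.

(** * Subobjects and their characteristic maps *)

Section Classifier.

Context (C : Category) (topC : IsTopos C) (one Omega : C) (tr : Hom one Omega)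
  (cl : IsSubobjectClassifier tr).

Definition Holds (A W : C) (chi : Hom A Omega) (w : Hom W A) : Prop :=
  exists t : Hom W one, chi ∘ w = tr ∘ t.

Lemma monic_holds (A : C) (chi : Hom A Omega) :
  exists (U : C) (m : Hom U A), Monic m /\
    forall (W : C) (w : Hom W A), Holds chi w <-> Factors m w.
Proof.
destruct (topos_pullbacks topC chi tr) as [P].
exists P, (pb_fst P); split.
- intros W x y e; apply (pb_unique (pb_universal P)); trivial.
  apply terminal_unique, cl.
- intros W w; split.
  + intros [t e]; exists (pb_lift (pb_universal P) e); apply pb_lift_fst.
  + intros [u <-]; exists (pb_snd P ∘ u).
    rewrite !comp_assoc; now rewrite (pb_comm (pb_universal P)).
Qed.

Lemma holds_char (U A : C) (m : Hom U A) : Monic m ->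
  exists chi : Hom A Omega,
    forall (W : C) (w : Hom W A), Holds chi w <-> Factors m w.
Proof.
intros Hm; destruct (proj2 cl U A m Hm) as [chi [[t [P]] _]].
exists chi; intros W w; split.
- intros [t' e]; exists (pb_lift P e); apply pb_lift_fst.
- intros [u <-]; exists (t ∘ u); rewrite !comp_assoc; now rewrite (pb_comm P).
Qed.

(** Turns the elementwise description of [m] into the pullback square that the uniqueness clause of
    the classifier asks for. The map [r] embeds the actual pullback of [tr] into [U]. *)
Lemma holds_pullback (U A : C) (m : Hom U A) (chi : Hom A Omega) : Monic m ->
  (forall (W : C) (w : Hom W A), Holds chi w <-> Factors m w) ->
  exists t : Hom U one, inhabited (IsPullback chi tr m t).
Proof.
intros Hm H.
destruct (topos_pullbacks topC chi tr) as [P].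
destruct (proj2 (H U m) (factors_self m)) as [t e].
destruct (proj1 (H P (pb_fst P))) as [r er].
{ exists (pb_snd P); apply (pb_comm (pb_universal P)). }
exists t; constructor.
apply (@MkIsPullback _ _ _ _ _ _ _ _ _ e
  (fun D h k e' => r ∘ pb_lift (pb_universal P) e')).
- intros D h k e'; now rewrite comp_assoc, er, pb_lift_fst.
- intros; apply terminal_unique, cl.
- intros D u v e' _; now apply Hm.
Qed.

(** Both maps classify the subobject cut out by [chi1], and a characteristic map is unique. *)
Lemma holds_ext (A : C) (chi1 chi2 : Hom A Omega) :
  (forall (W : C) (w : Hom W A), Holds chi1 w <-> Holds chi2 w) -> chi1 = chi2.
Proof.
intros H; destruct (monic_holds chi1) as (U & m & Hm & Hchi1).
destruct (proj2 cl U A m Hm) as [chi [_ Hchi]].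
rewrite <- (Hchi chi1), <- (Hchi chi2); trivial; apply holds_pullback; trivial.
intros W w; rewrite <- H; apply Hchi1.
Qed.

Lemma holds_comp (A B W : C) (chi : Hom B Omega) (f : Hom A B) (w : Hom W A) :
  Holds (chi ∘ f) w <-> Holds chi (f ∘ w).
Proof. unfold Holds; now rewrite comp_assoc. Qed.

End Classifier.

(** * Subobjects of a pushout *)

Section Topos.

Context (C : Category) (topC : IsTopos C).

(** The characteristic maps of [m] and [n] agree after composition with [i] and with [j], hence
    agree on the pushout. *)
Lemma pushout_subobject_ext (Y S T P Q R : C) (f : Hom Y S) (g : Hom Y T)
    (i : Hom S P) (j : Hom T P) (m : Hom Q P) (n : Hom R P) :
  PushoutSquare f g i j -> Monic m -> Monic n ->
  (forall (W : C) (s : Hom W S), Factors m (i ∘ s) <-> Factors n (i ∘ s)) ->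
  (forall (W : C) (t : Hom W T), Factors m (j ∘ t) <-> Factors n (j ∘ t)) ->
  forall (W : C) (w : Hom W P), Factors m w <-> Factors n w.
Proof.
intros HP Hm Hn HS HT W w.
destruct (topos_classifier topC) as (one & Omega & tr & cl).
destruct (holds_char cl Hm) as [cm Hcm], (holds_char cl Hn) as [cn Hcn].
rewrite <- Hcm, <- Hcn.
replace cn with cm; [reflexivity |].
apply (pushout_ext HP); apply (holds_ext topC cl); intros V v;
  rewrite !holds_comp, Hcm, Hcn; trivial.
Qed.

(** Equal inverse images in [Y] mean that the characteristic maps of [a] and [b] form a cocone under
    [f] and [g]. The induced map from [P] to [Omega] classifies the glued subobject. *)
Lemma pushout_subobject_glue (Y S T P A B : C) (f : Hom Y S) (g : Hom Y T)
    (i : Hom S P) (j : Hom T P) (a : Hom A S) (b : Hom B T) :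
  PushoutSquare f g i j -> Monic a -> Monic b ->
  (forall (W : C) (y : Hom W Y), Factors a (f ∘ y) <-> Factors b (g ∘ y)) ->
  exists (G : C) (n : Hom G P), Monic n /\
    (forall (W : C) (s : Hom W S), Factors n (i ∘ s) <-> Factors a s) /\
    (forall (W : C) (t : Hom W T), Factors n (j ∘ t) <-> Factors b t).
Proof.
intros HP Ha Hb H.
destruct (topos_classifier topC) as (one & Omega & tr & cl).
destruct (holds_char cl Ha) as [ca Hca], (holds_char cl Hb) as [cb Hcb].
destruct (proj2 HP Omega ca cb) as [c [[ci cj] _]].
{ apply (holds_ext topC cl); intros W w; rewrite !holds_comp, Hca, Hcb; trivial. }
destruct (monic_holds topC cl c) as (G & n & Hn & Hc).
exists G, n; split; [exact Hn | split].
- intros W s; rewrite <- Hc, <- holds_comp, ci; apply Hca.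
- intros W t; rewrite <- Hc, <- holds_comp, cj; apply Hcb.
Qed.

(** * Products preserve pushouts *)

Lemma transpose_comp (A B E EA : C) (p : Hom EA E) (q : Hom EA A) (ev : Hom EA B)
    (X Y XA YA : C) (pX : Hom XA X) (qX : Hom XA A) (pY : Hom YA Y) (qY : Hom YA A)
    (f : Hom X Y) (fA : Hom XA YA) (h : Hom XA B) (k : Hom YA B)
    (h' : Hom X E) (k' : Hom Y E) (uh : Hom XA EA) (uk : Hom YA EA) :
  IsExponential p q ev -> IsProduct pX qX ->
  pY ∘ fA = f ∘ pX -> qY ∘ fA = qX ->
  p ∘ uh = h' ∘ pX -> q ∘ uh = qX -> ev ∘ uh = h ->
  p ∘ uk = k' ∘ pY -> q ∘ uk = qY -> ev ∘ uk = k ->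
  k ∘ fA = h -> k' ∘ f = h'.
Proof.
intros [_ Hexp] HX pf qf ph qh evh pk qk evk e.
destruct (Hexp _ _ _ _ HX h) as [t [_ Ht]].
transitivity t; [symmetry |]; apply Ht.
- exists (uk ∘ fA); repeat split.
  + rewrite comp_assoc, pk, <- !comp_assoc; congruence.
  + rewrite comp_assoc; congruence.
  + rewrite comp_assoc; congruence.
- now exists uh.
Qed.

(** The functor [- × A] has a right adjoint: a cocone on the products transposes to a cocone with
    vertex the exponential [E], which descends to [P] and is transposed back. *)
Lemma pushout_product (A Y S T P YA SA TA PA : C) (f : Hom Y S) (g : Hom Y T)
    (i : Hom S P) (j : Hom T P)
    (pY : Hom YA Y) (qY : Hom YA A) (pS : Hom SA S) (qS : Hom SA A)
    (pT : Hom TA T) (qT : Hom TA A) (pP : Hom PA P) (qP : Hom PA A)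
    (fA : Hom YA SA) (gA : Hom YA TA) (iA : Hom SA PA) (jA : Hom TA PA) :
  PushoutSquare f g i j ->
  IsProduct pY qY -> IsProduct pS qS -> IsProduct pT qT -> IsProduct pP qP ->
  pS ∘ fA = f ∘ pY -> qS ∘ fA = qY -> pT ∘ gA = g ∘ pY -> qT ∘ gA = qY ->
  pP ∘ iA = i ∘ pS -> qP ∘ iA = qS -> pP ∘ jA = j ∘ pT -> qP ∘ jA = qT ->
  PushoutSquare fA gA iA jA.
Proof.
intros HP HY HS HT HPA pf qf pg qg pi qi pj qj; split.
{ apply (product_ext HPA).
  - rewrite !comp_assoc, pi, pj, <- !comp_assoc, pf, pg, !comp_assoc.
    now rewrite (proj1 HP).
  - rewrite !comp_assoc; congruence. }
intros D h k e.
destruct (topos_exponentials topC A D) as (E & EA & p & q & ev & Hexp).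
destruct (proj2 Hexp _ _ _ _ HS h) as [h' [[uh (ph & qh & evh)] _]].
destruct (proj2 Hexp _ _ _ _ HT k) as [k' [[uk (pk & qk & evk)] _]].
destruct (proj2 Hexp _ _ _ _ HY (h ∘ fA)) as [l' [[ul (pl & ql & evl)] _]].
destruct (proj2 HP E h' k') as [c [[ci cj] Hc]].
(* Both restrictions to [Y] are the transpose [l'] of the common map [h ∘ fA = k ∘ gA], by
   naturality of transposition. *)
{ transitivity l'.
  - exact (transpose_comp Hexp HY pf qf pl ql evl ph qh evh eq_refl).
  - symmetry; exact (transpose_comp Hexp HY pg qg pl ql evl pk qk evk (eq_sym e)). }
destruct (product_pair (c ∘ pP) qP (proj1 Hexp)) as [uc [pc qc]].
exists (ev ∘ uc); split; [split |].
- rewrite <- evh, <- comp_assoc; f_equal; apply (product_ext (proj1 Hexp)).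
  + rewrite comp_assoc, pc, <- comp_assoc, pi, comp_assoc; congruence.
  + rewrite comp_assoc; congruence.
- rewrite <- evk, <- comp_assoc; f_equal; apply (product_ext (proj1 Hexp)).
  + rewrite comp_assoc, pc, <- comp_assoc, pj, comp_assoc; congruence.
  + rewrite comp_assoc; congruence.
- intros v [vi vj].
  destruct (proj2 Hexp _ _ _ _ HPA v) as [v' [[uv (pv & qv & evv)] _]].
  rewrite <- evv; f_equal; apply (product_ext (proj1 Hexp)); [| congruence].
  rewrite pc, pv; f_equal; apply Hc; split.
  + exact (transpose_comp Hexp HS pi qi ph qh evh pv qv evv vi).
  + exact (transpose_comp Hexp HT pj qj pk qk evk pv qv evv vj).
Qed.

Lemma topos_pushout_product (A Y S T P PA : C) (f : Hom Y S) (g : Hom Y T)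
    (i : Hom S P) (j : Hom T P) (pP : Hom PA P) (qP : Hom PA A) :
  PushoutSquare f g i j -> IsProduct pP qP ->
  exists (YA SA TA : C) (pY : Hom YA Y) (qY : Hom YA A)
    (pS : Hom SA S) (qS : Hom SA A) (pT : Hom TA T) (qT : Hom TA A)
    (fA : Hom YA SA) (gA : Hom YA TA) (iA : Hom SA PA) (jA : Hom TA PA),
    PushoutSquare fA gA iA jA /\ IsProduct pS qS /\ IsProduct pT qT /\
    IsProduct pY qY /\
    (pS ∘ fA = f ∘ pY /\ qS ∘ fA = qY) /\ (pT ∘ gA = g ∘ pY /\ qT ∘ gA = qY) /\
    (pP ∘ iA = i ∘ pS /\ qP ∘ iA = qS) /\ (pP ∘ jA = j ∘ pT /\ qP ∘ jA = qT).
Proof.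
intros HP HPA.
destruct (topos_product topC Y A) as (YA & pY & qY & HY).
destruct (topos_product topC S A) as (SA & pS & qS & HS).
destruct (topos_product topC T A) as (TA & pT & qT & HT).
destruct (product_pair (f ∘ pY) qY HS) as [fA [pf qf]].
destruct (product_pair (g ∘ pY) qY HT) as [gA [pg qg]].
destruct (product_pair (i ∘ pS) qS HPA) as [iA [pi qi]].
destruct (product_pair (j ∘ pT) qT HPA) as [jA [pj qj]].
exists YA, SA, TA, pY, qY, pS, qS, pT, qT, fA, gA, iA, jA.
repeat split; trivial; now apply (pushout_product HP HY HS HT HPA).
Qed.

(** * Restricting a pushout to a subobject *)

(* The hypotheses say that the relation [n] from [P] to [D] is functional over
   [S] and [T].  Functionality is the equality of the subobjects
   [{(p, d, d') | n(p, d) /\ n(p, d')}] and [{(p, d, d) | n(p, d)}] of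
   [P × (D × D)], so it can be tested on [S × (D × D)] and [T × (D × D)]. *)
Lemma pushout_functional_relation (D Y S T P PD G : C) (f : Hom Y S) (g : Hom Y T)
    (i : Hom S P) (j : Hom T P) (p : Hom PD P) (q : Hom PD D) (n : Hom G PD) :
  PushoutSquare f g i j -> IsProduct p q -> Monic n ->
  (forall (W : C) (x y : Hom W G) (s : Hom W S),
    p ∘ n ∘ x = i ∘ s -> p ∘ n ∘ y = i ∘ s -> x = y) ->
  (forall (W : C) (x y : Hom W G) (t : Hom W T),
    p ∘ n ∘ x = j ∘ t -> p ∘ n ∘ y = j ∘ t -> x = y) ->
  Monic (p ∘ n).
Proof.
intros HP Hpq Hn HS HT.
destruct (topos_product topC D D) as (DD & d1 & d2 & HDD).
destruct (topos_product topC P DD) as (PE & pP & qP & HPE).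
destruct (topos_pushout_product HP HPE)
  as (YE & SE & TE & pY & qY & pS & qS & pT & qT & fE & gE & iE & jE &
      HPOE & _ & _ & _ & _ & _ & [pi _] & [pj _]).
(* The kernel pair [K] of [p ∘ n] consists of pairs in the relation over the same point of [P].
   Below, [kap] embeds [K] in [P × (D × D)] as the triples [(p, d, d')], and [del] embeds [G] as the
   triples [(p, d, d)]. *)
destruct (topos_pullbacks topC (p ∘ n) (p ∘ n)) as [K].
assert (cK := pb_comm (pb_universal K)).
set (k1 := pb_fst K) in *; set (k2 := pb_snd K) in *.
destruct (product_pair (q ∘ n ∘ k1) (q ∘ n ∘ k2) HDD) as [dk [dk1 dk2]].
destruct (product_pair (q ∘ n) (q ∘ n) HDD) as [dg [dg1 dg2]].
destruct (product_pair (p ∘ n ∘ k1) dk HPE) as [kap [kapP kapQ]].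
destruct (product_pair (p ∘ n) dg HPE) as [del [delP delQ]].
assert (extG : forall (W : C) (x y : Hom W G),
  p ∘ n ∘ x = p ∘ n ∘ y -> q ∘ n ∘ x = q ∘ n ∘ y -> x = y).
{ intros W x y e1 e2; apply Hn, (product_ext Hpq); now rewrite !comp_assoc. }
assert (kap1 : d1 ∘ qP ∘ kap = q ∘ n ∘ k1) by (rewrite <- comp_assoc; congruence).
assert (kap2 : d2 ∘ qP ∘ kap = q ∘ n ∘ k2) by (rewrite <- comp_assoc; congruence).
assert (del1 : d1 ∘ qP ∘ del = q ∘ n) by (rewrite <- comp_assoc; congruence).
assert (del2 : d2 ∘ qP ∘ del = q ∘ n) by (rewrite <- comp_assoc; congruence).
assert (Hkap : Monic kap).
{ intros W x y e.
  assert (eP : p ∘ n ∘ k1 ∘ x = p ∘ n ∘ k1 ∘ y)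
    by (rewrite <- kapP, <- !comp_assoc; congruence).
  apply (pb_unique (pb_universal K)); fold k1 k2;
    apply extG; rewrite !comp_assoc; trivial.
  - rewrite <- kap1, <- !comp_assoc; congruence.
  - now rewrite <- cK.
  - rewrite <- kap2, <- !comp_assoc; congruence. }
assert (Hdel : Monic del).
{ intros W x y e; apply extG.
  - rewrite <- delP, <- !comp_assoc; congruence.
  - rewrite <- del1, <- !comp_assoc; congruence. }
assert (diag : forall (W : C) (r : Hom W K),
  k1 ∘ r = k2 ∘ r -> Factors del (kap ∘ r)).
{ intros W r e; exists (k1 ∘ r); apply (product_ext HPE).
  - rewrite !comp_assoc; congruence.
  - apply (product_ext HDD); rewrite !comp_assoc.
    + congruence.
    + rewrite del2, kap2, <- !comp_assoc; congruence. }
assert (incl : forall (W : C) (w : Hom W PE), Factors del w -> Factors kap w).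
{ intros W w [r <-].
  set (l := pb_lift (pb_universal K) (eq_refl (p ∘ n ∘ r))).
  assert (l1 : k1 ∘ l = r) by apply pb_lift_fst.
  assert (l2 : k2 ∘ l = r) by apply pb_lift_snd.
  exists l; apply (product_ext HPE).
  - rewrite !comp_assoc, kapP, delP, <- comp_assoc; congruence.
  - apply (product_ext HDD); rewrite !comp_assoc.
    + rewrite kap1, del1, <- comp_assoc; congruence.
    + rewrite kap2, del2, <- comp_assoc; congruence. }
assert (Hfac : Factors del kap).
(* Over [S] or [T] the two members of a pair in [K] coincide by hypothesis, so the triple is
   diagonal by [diag]. *)
{ apply (pushout_subobject_ext HPOE Hkap Hdel); [ | | apply factors_self ].
  - intros W w; split; [| apply incl].
    intros [r e]; rewrite <- e; apply diag, (HS _ _ _ (pS ∘ w)).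
    + rewrite !comp_assoc, <- kapP, <- pi, <- !comp_assoc; congruence.
    + rewrite !comp_assoc, <- cK, <- kapP, <- pi, <- !comp_assoc; congruence.
  - intros W w; split; [| apply incl].
    intros [r e]; rewrite <- e; apply diag, (HT _ _ _ (pT ∘ w)).
    + rewrite !comp_assoc, <- kapP, <- pj, <- !comp_assoc; congruence.
    + rewrite !comp_assoc, <- cK, <- kapP, <- pj, <- !comp_assoc; congruence. }
destruct Hfac as [r er].
(* All of [K] is now diagonal; equal kernel pair projections make [p ∘ n] monic. *)
assert (k12 : k1 = k2).
{ apply extG; trivial.
  rewrite <- kap1, <- kap2, <- er, !comp_assoc; congruence. }
intros W x y e.
transitivity (k1 ∘ pb_lift (pb_universal K) e); [symmetry; apply pb_lift_fst |].
rewrite k12; apply pb_lift_snd.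
Qed.

(** The factorisation hypotheses, with [m ∘ i1 = i ∘ a] and [m ∘ j1 = j ∘ b], make [a] and [b] the
    inverse images of [m]. Uniqueness of induced maps comes from an equalizer, existence from gluing
    graphs. *)
Lemma pushout_restrict (Y S T P S1 T1 Q : C) (f : Hom Y S) (g : Hom Y T)
    (i : Hom S P) (j : Hom T P) (a : Hom S1 S) (b : Hom T1 T) (m : Hom Q P)
    (f1 : Hom Y S1) (g1 : Hom Y T1) (i1 : Hom S1 Q) (j1 : Hom T1 Q) :
  PushoutSquare f g i j -> Monic a -> Monic b -> Monic m ->
  a ∘ f1 = f -> b ∘ g1 = g -> m ∘ i1 = i ∘ a -> m ∘ j1 = j ∘ b ->
  (forall (W : C) (s : Hom W S), Factors m (i ∘ s) -> Factors a s) ->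
  (forall (W : C) (t : Hom W T), Factors m (j ∘ t) -> Factors b t) ->
  PushoutSquare f1 g1 i1 j1.
Proof.
intros HP Ha Hb Hm ef eg ei ej HS HT; split.
{ apply Hm; rewrite !comp_assoc, ei, ej, <- !comp_assoc, ef, eg; apply HP. }
intros D h k e.
assert (uniq : forall u v : Hom Q D,
  u ∘ i1 = v ∘ i1 -> u ∘ j1 = v ∘ j1 -> u = v).
{ intros u v ui uj.
  (* The equalizer contains the images of [i1] and [j1], so it has the same inverse images in [S]
     and [T] as [Q] and must be all of [Q]. *)
  destruct (topos_equalizer topC u v) as (E & eq & Heq & ceq & Feq).
  assert (Hfac : Factors (m ∘ eq) m).
  { apply (pushout_subobject_ext HP Hm (monic_comp Hm Heq));
      [ | | apply factors_self].
    - intros W s; split.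
      + intros Hs; destruct (HS _ _ Hs) as [x <-].
        destruct (factors_comp x (Feq _ i1 ui)) as [y ey].
        exists y; rewrite <- comp_assoc, ey, !comp_assoc; congruence.
      + intros [x <-]; exists (eq ∘ x); apply comp_assoc.
    - intros W s; split.
      + intros Hs; destruct (HT _ _ Hs) as [x <-].
        destruct (factors_comp x (Feq _ j1 uj)) as [y ey].
        exists y; rewrite <- comp_assoc, ey, !comp_assoc; congruence.
      + intros [x <-]; exists (eq ∘ x); apply comp_assoc. }
  destruct Hfac as [r er].
  assert (er' : eq ∘ r = idm Q)
    by (apply Hm; rewrite comp_id_r, comp_assoc; exact er).
  rewrite <- (comp_id_r u), <- (comp_id_r v), <- er', !comp_assoc; congruence. }
cut (exists u : Hom Q D, u ∘ i1 = h /\ u ∘ j1 = k).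
{ intros [u [ui uj]]; exists u; split; [now split |].
  intros v [vi vj]; apply uniq; congruence. }
destruct (topos_product topC P D) as (PD & p & q & Hpq).
destruct (topos_pushout_product HP Hpq)
  as (YD & SD & TD & pY & qY & pS & qS & pT & qT & fD & gD & iD & jD &
      HPD & HSD & HTD & HYD & [pf qf] & [pg qg] & [pi qi] & [pj qj]).
(* [gh] and [gk] are the graphs of [h] and [k], as subobjects of [S × D] and [T × D]. *)
destruct (product_pair a h HSD) as [gh [gh1 gh2]].
destruct (product_pair b k HTD) as [gk [gk1 gk2]].
assert (Hgh : Monic gh).
{ intros W x y exy; apply Ha; rewrite <- gh1, <- !comp_assoc; congruence. }
assert (Hgk : Monic gk).
{ intros W x y exy; apply Hb; rewrite <- gk1, <- !comp_assoc; congruence. }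
destruct (pushout_subobject_glue HPD Hgh Hgk) as (G & n & Hn & HnS & HnT).
{ (* both sides say that [y] lies on the graph of [h ∘ f1 = k ∘ g1] *)
  intros W y; transitivity (qY ∘ y = h ∘ f1 ∘ pY ∘ y); split.
  - intros [x ex].
    assert (ex1 : x = f1 ∘ pY ∘ y).
    { apply Ha; rewrite <- gh1 at 1; rewrite <- comp_assoc, ex, !comp_assoc.
      congruence. }
    rewrite <- qf, <- comp_assoc, <- ex, comp_assoc, gh2, ex1, !comp_assoc.
    reflexivity.
  - intros ey; exists (f1 ∘ pY ∘ y); apply (product_ext HSD);
      rewrite !comp_assoc; congruence.
  - intros ey; exists (g1 ∘ pY ∘ y); apply (product_ext HTD);
      rewrite !comp_assoc; congruence.
  - intros [x ex].
    assert (ex1 : x = g1 ∘ pY ∘ y).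
    { apply Hb; rewrite <- gk1 at 1; rewrite <- comp_assoc, ex, !comp_assoc.
      congruence. }
    rewrite <- qg, <- comp_assoc, <- ex, comp_assoc, gk2, ex1, !comp_assoc.
    congruence. }
(* An element of the glued relation [G] lying over [s] belongs to the graph of [h]: [s] comes from
   some [z] in [S1], and the value is [h ∘ z]. *)
assert (overS : forall (W : C) (x : Hom W G) (s : Hom W S), p ∘ n ∘ x = i ∘ s ->
  exists z : Hom W S1, a ∘ z = s /\ q ∘ n ∘ x = h ∘ z).
{ intros W x s ex.
  destruct (product_pair s (q ∘ n ∘ x) HSD) as [w [w1 w2]].
  assert (ew : iD ∘ w = n ∘ x).
  { apply (product_ext Hpq); rewrite !comp_assoc; [| congruence].
    rewrite pi, <- comp_assoc; congruence. }
  destruct (proj1 (HnS W w)) as [z ez]; [now exists x |].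
  exists z; rewrite <- gh1, <- gh2, <- !comp_assoc, ez, w1, w2, <- comp_assoc.
  now split. }
assert (overT : forall (W : C) (x : Hom W G) (t : Hom W T), p ∘ n ∘ x = j ∘ t ->
  exists z : Hom W T1, b ∘ z = t /\ q ∘ n ∘ x = k ∘ z).
{ intros W x t ex.
  destruct (product_pair t (q ∘ n ∘ x) HTD) as [w [w1 w2]].
  assert (ew : jD ∘ w = n ∘ x).
  { apply (product_ext Hpq); rewrite !comp_assoc; [| congruence].
    rewrite pj, <- comp_assoc; congruence. }
  destruct (proj1 (HnT W w)) as [z ez]; [now exists x |].
  exists z; rewrite <- gk1, <- gk2, <- !comp_assoc, ez, w1, w2, <- comp_assoc.
  now split. }
assert (Hpn : Monic (p ∘ n)).
{ apply (pushout_functional_relation HP Hpq Hn).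
  - intros W x y s ex ey.
    destruct (overS _ _ _ ex) as [z [z1 z2]], (overS _ _ _ ey) as [z' [z1' z2']].
    assert (z = z') by (apply Ha; congruence); subst z'.
    apply Hn, (product_ext Hpq); rewrite !comp_assoc; congruence.
  - intros W x y t ex ey.
    destruct (overT _ _ _ ex) as [z [z1 z2]], (overT _ _ _ ey) as [z' [z1' z2']].
    assert (z = z') by (apply Hb; congruence); subst z'.
    apply Hn, (product_ext Hpq); rewrite !comp_assoc; congruence. }
(* The domain of the relation and [Q] have the same inverse images [a] and [b], hence [Q] lies in
   the domain. The resulting [r] sends a point of [Q] to its pair in the relation, and [q ∘ n ∘ r]
   reads off the value. *)
assert (Hfac : Factors (p ∘ n) m).
{ apply (pushout_subobject_ext HP Hm Hpn); [ | | apply factors_self].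
  - intros W s; split.
    + intros Hs; destruct (HS _ _ Hs) as [x <-].
      destruct (proj2 (HnS _ (gh ∘ x)) (factors_comp x (factors_self gh)))
        as [r er].
      exists r; rewrite <- comp_assoc, er, !comp_assoc, pi.
      now rewrite <- (comp_assoc i), gh1.
    + intros [x ex]; destruct (overS _ _ _ ex) as [z [<- _]].
      exists (i1 ∘ z); rewrite !comp_assoc; congruence.
  - intros W t; split.
    + intros Ht; destruct (HT _ _ Ht) as [x <-].
      destruct (proj2 (HnT _ (gk ∘ x)) (factors_comp x (factors_self gk)))
        as [r er].
      exists r; rewrite <- comp_assoc, er, !comp_assoc, pj.
      now rewrite <- (comp_assoc j), gk1.
    + intros [x ex]; destruct (overT _ _ _ ex) as [z [<- _]].
      exists (j1 ∘ z); rewrite !comp_assoc; congruence. }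
destruct Hfac as [r er].
exists (q ∘ n ∘ r); split.
(* Since [r ∘ i1] lies over [a] itself, the point [z] of [S1] is the identity. *)
- destruct (overS _ (r ∘ i1) a) as [z [z1 z2]].
  { rewrite comp_assoc; congruence. }
  assert (z = idm S1) by (apply Ha; now rewrite comp_id_r); subst z.
  rewrite <- comp_assoc, z2; apply comp_id_r.
- destruct (overT _ (r ∘ j1) b) as [z [z1 z2]].
  { rewrite comp_assoc; congruence. }
  assert (z = idm T1) by (apply Hb; now rewrite comp_id_r); subst z.
  rewrite <- comp_assoc, z2; apply comp_id_r.
Qed.

(** Glue [a] and [b] to a subobject [G] of [P]. By [pushout_restrict], [G] is also a pushout of [S1]
    and [T1] over [Y], so [P1] is isomorphic to it over [P] and inherits its inverse images. *)
Lemma pushout_of_monics (Y S T P S1 T1 P1 : C) (f : Hom Y S) (g : Hom Y T)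
    (i : Hom S P) (j : Hom T P) (a : Hom S1 S) (b : Hom T1 T) (m : Hom P1 P)
    (f1 : Hom Y S1) (g1 : Hom Y T1) (i1 : Hom S1 P1) (j1 : Hom T1 P1) :
  PushoutSquare f g i j -> PushoutSquare f1 g1 i1 j1 -> Monic a -> Monic b ->
  a ∘ f1 = f -> b ∘ g1 = g -> m ∘ i1 = i ∘ a -> m ∘ j1 = j ∘ b ->
  Monic m /\
  (forall (W : C) (s : Hom W S), Factors m (i ∘ s) -> Factors a s) /\
  (forall (W : C) (t : Hom W T), Factors m (j ∘ t) -> Factors b t).
Proof.
intros HP HP1 Ha Hb ef eg ei ej.
destruct (pushout_subobject_glue HP Ha Hb) as (G & n & Hn & HS & HT).
(* As [f] and [g] factor through [a] and [b], both inverse images in [Y] are all of [Y]. *)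
{ intros W y; split; intros _.
  - exists (g1 ∘ y); rewrite comp_assoc; congruence.
  - exists (f1 ∘ y); rewrite comp_assoc; congruence. }
destruct (proj2 (HS _ a) (factors_self a)) as [i2 ei2].
destruct (proj2 (HT _ b) (factors_self b)) as [j2 ej2].
assert (HG : PushoutSquare f1 g1 i2 j2).
{ apply (pushout_restrict HP Ha Hb Hn ef eg ei2 ej2); [apply HS | apply HT]. }
destruct (proj2 HP1 G i2 j2 (proj1 HG)) as [u [[ui uj] _]].
destruct (pushout_comparison HP1 HG ui uj) as [v [vu _]].
assert (em : n ∘ u = m).
{ apply (pushout_ext HP1); rewrite <- comp_assoc; congruence. }
assert (Hmn : forall (W : C) (w : Hom W P), Factors m w -> Factors n w).
{ intros W w [x <-]; exists (u ∘ x); rewrite comp_assoc; congruence. }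
split; [| split].
- rewrite <- em; apply monic_comp; trivial.
  intros W x y e.
  rewrite <- (comp_id_l x), <- (comp_id_l y), <- vu, <- !comp_assoc; congruence.
- intros W s Hs; now apply HS, Hmn.
- intros W t Ht; now apply HT, Hmn.
Qed.

End Topos.

(** * The interchange isomorphism *)

Theorem theorem2p7
  (C : Category) (topC : IsTopos C) (X Y Z : C)
  (L S L' : Cospan X Y) (R T R' : Cospan Y Z)
  (s' : SpanOfCospans L S) (s'' : SpanOfCospans S L')
  (t' : SpanOfCospans R T) (t'' : SpanOfCospans T R')
  (monic_s' : MonicLegs s') (monic_s'' : MonicLegs s'')
  (monic_t' : MonicLegs t') (monic_t'' : MonicLegs t'')
  (* chosen pushouts L +_Y R, S +_Y T, L' +_Y R', S' +_Y T', S'' +_Y T'' *)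
  (LR : Pushout (csr L) (csl R))
  (ST : Pushout (csr S) (csl T))
  (LR' : Pushout (csr L') (csl R'))
  (ST' : Pushout (csr s') (csl t'))
  (ST'' : Pushout (csr s'') (csl t''))
  (* chosen pullbacks S' ×_S S'', T' ×_T T'' *)
  (SS : Pullback (legr s') (legl s''))
  (TT : Pullback (legr t') (legl t''))
  (* the two sides: (S' ×_S S'') +_Y (T' ×_T T'') and
     (S' +_Y T') ×_(S +_Y T) (S'' +_Y T'') *)
  (lhs : Pushout (csr (vcomp SS)) (csl (vcomp TT)))
  (rhs : Pullback (legr (hcomp LR ST ST')) (legl (hcomp ST LR' ST''))) :
  exists phi : SpanHom (hcomp LR LR' lhs) (vcomp rhs),
    pb_fst rhs ∘ phi = hcomp_hom (vcomp_fst SS) (vcomp_fst TT) lhs ST' /\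
    pb_snd rhs ∘ phi = hcomp_hom (vcomp_snd SS) (vcomp_snd TT) lhs ST'' /\
    IsIso phi.
Proof.
pose (m1 := legr (hcomp LR ST ST') : Hom ST' ST).
pose (m2 := legl (hcomp ST LR' ST'') : Hom ST'' ST).
pose (r1 := pb_fst rhs : Hom rhs ST').
pose (r2 := pb_snd rhs : Hom rhs ST'').
pose (il := po_inl lhs : Hom SS lhs).
pose (ir := po_inr lhs : Hom TT lhs).
pose (H1 := hcomp_hom (vcomp_fst SS) (vcomp_fst TT) lhs ST').
pose (H2 := hcomp_hom (vcomp_snd SS) (vcomp_snd TT) lhs ST'').
pose (h1 := H1 : Hom lhs ST').
pose (h2 := H2 : Hom lhs ST'').
assert (m1l : m1 ∘ po_inl ST' = po_inl ST ∘ legr s') by apply po_desc_inl.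
assert (m1r : m1 ∘ po_inr ST' = po_inr ST ∘ legr t') by apply po_desc_inr.
assert (m2l : m2 ∘ po_inl ST'' = po_inl ST ∘ legl s'') by apply po_desc_inl.
assert (m2r : m2 ∘ po_inr ST'' = po_inr ST ∘ legl t'') by apply po_desc_inr.
assert (h1l : h1 ∘ il = po_inl ST' ∘ pb_fst SS) by apply po_desc_inl.
assert (h1r : h1 ∘ ir = po_inr ST' ∘ pb_fst TT) by apply po_desc_inr.
assert (h2l : h2 ∘ il = po_inl ST'' ∘ pb_snd SS) by apply po_desc_inl.
assert (h2r : h2 ∘ ir = po_inr ST'' ∘ pb_snd TT) by apply po_desc_inr.
assert (Hlhs : @PushoutSquare C Y SS TT (csr (vcomp SS)) (csl (vcomp TT)) lhs il ir)
  by exact (pushout_square lhs).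
assert (HST := pushout_square ST).
assert (cSS := pb_comm (pb_universal SS)).
assert (cTT := pb_comm (pb_universal TT)).
assert (c : m1 ∘ h1 = m2 ∘ h2).
{ apply (pushout_ext Hlhs); rewrite <- !comp_assoc.
  - rewrite h1l, h2l, !comp_assoc, m1l, m2l, <- !comp_assoc; congruence.
  - rewrite h1r, h2r, !comp_assoc, m1r, m2r, <- !comp_assoc; congruence. }
pose (u := pb_lift (pb_universal rhs) c : Hom lhs rhs).
assert (u1 : r1 ∘ u = h1) by apply pb_lift_fst.
assert (u2 : r2 ∘ u = h2) by apply pb_lift_snd.
assert (Hiso : IsIso u).
{ destruct (pushout_of_monics topC HST (pushout_square ST')
    (proj2 monic_s') (proj2 monic_t') (ch_csr (legr s')) (ch_csl (legr t'))
    m1l m1r) as (Hm1 & HS1 & HT1).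
  destruct (pushout_of_monics topC HST (pushout_square ST'')
    (proj1 monic_s'') (proj1 monic_t'') (ch_csr (legl s'')) (ch_csl (legl t''))
    m2l m2r) as (Hm2 & HS2 & HT2).
  (* It is enough that [u ∘ il] and [u ∘ ir] exhibit [rhs] as a pushout too. Here [m1 ∘ r1]
     represents the intersection of [m1] and [m2] in [S +_Y T], and its inverse images are the
     intersections [SS] in [S] and [TT] in [T]. *)
  apply (@pushout_comparison _ _ _ _ _ _ _ _ _ _ (u ∘ il) (u ∘ ir)
    _ Hlhs); trivial.
  apply (@pushout_restrict _ topC _ _ _ _ _ _ _ _ _ _ _
    (legr s' ∘ pb_fst SS) (legr t' ∘ pb_fst TT) (m1 ∘ r1) _ _ _ _ HST).
  - apply monic_pullback_diagonal; [apply monic_s' | apply monic_s''].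
  - apply monic_pullback_diagonal; [apply monic_t' | apply monic_t''].
  - exact (monic_pullback_diagonal (P := rhs) Hm1 Hm2).
  - rewrite <- (ch_csr (legr s')), <- comp_assoc; f_equal.
    exact (ch_csr (vcomp_fst SS)).
  - rewrite <- (ch_csl (legr t')), <- comp_assoc; f_equal.
    exact (ch_csl (vcomp_fst TT)).
  - rewrite !comp_assoc, <- m1l, <- !comp_assoc, <- h1l, <- u1.
    now rewrite !comp_assoc.
  - rewrite !comp_assoc, <- m1r, <- !comp_assoc, <- h1r, <- u1.
    now rewrite !comp_assoc.
  - intros W w Hw.
    destruct (proj1 (factors_pullback_diagonal rhs _) Hw) as [w1 w2].
    apply factors_pullback_diagonal; split; [now apply HS1 | now apply HS2].
  - intros W w Hw.
    destruct (proj1 (factors_pullback_diagonal rhs _) Hw) as [w1 w2].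
    apply factors_pullback_diagonal; split; [now apply HT1 | now apply HT2]. }
(* Compatibility with the outer legs is checked on the two pushout injections of [lhs]. *)
assert (legs_l : (legl (hcomp LR ST ST') : Hom ST' LR) ∘ r1 ∘ u
  = (legl (hcomp LR LR' lhs) : Hom lhs LR)).
{ rewrite <- comp_assoc, u1; apply (pushout_ext Hlhs); rewrite <- comp_assoc.
  - rewrite h1l, comp_assoc; etransitivity; [| symmetry; apply po_desc_inl].
    etransitivity; [| exact (eq_sym (comp_assoc (po_inl LR) (legl s') (pb_fst SS)))].
    f_equal; apply po_desc_inl.
  - rewrite h1r, comp_assoc; etransitivity; [| symmetry; apply po_desc_inr].
    etransitivity; [| exact (eq_sym (comp_assoc (po_inr LR) (legl t') (pb_fst TT)))].
    f_equal; apply po_desc_inr. }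
assert (legs_r : (legr (hcomp ST LR' ST'') : Hom ST'' LR') ∘ r2 ∘ u
  = (legr (hcomp LR LR' lhs) : Hom lhs LR')).
{ rewrite <- comp_assoc, u2; apply (pushout_ext Hlhs); rewrite <- comp_assoc.
  - rewrite h2l, comp_assoc; etransitivity; [| symmetry; apply po_desc_inl].
    etransitivity; [| exact (eq_sym (comp_assoc (po_inl LR') (legr s'') (pb_snd SS)))].
    f_equal; apply po_desc_inl.
  - rewrite h2r, comp_assoc; etransitivity; [| symmetry; apply po_desc_inr].
    etransitivity; [| exact (eq_sym (comp_assoc (po_inr LR') (legr t'') (pb_snd TT)))].
    f_equal; apply po_desc_inr. }
(* Compatibility with the maps from [X] and [Z] is checked after the two projections of [rhs], where
   it holds for [H1] and [H2]. *)
assert (ul : u ∘ csl (hcomp_cospan lhs) = csl (vcomp rhs)).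
{ apply (pb_unique (pb_universal rhs)); rewrite comp_assoc.
  - etransitivity; [| symmetry; apply pb_lift_fst].
    etransitivity; [| exact (ch_csl H1)]; f_equal; exact u1.
  - etransitivity; [| symmetry; apply pb_lift_snd].
    etransitivity; [| exact (ch_csl H2)]; f_equal; exact u2. }
assert (ur : u ∘ csr (hcomp_cospan lhs) = csr (vcomp rhs)).
{ apply (pb_unique (pb_universal rhs)); rewrite comp_assoc.
  - etransitivity; [| symmetry; apply pb_lift_fst].
    etransitivity; [| exact (ch_csr H1)]; f_equal; exact u1.
  - etransitivity; [| symmetry; apply pb_lift_snd].
    etransitivity; [| exact (ch_csr H2)]; f_equal; exact u2. }
pose (v := @MkCospanHom _ _ _ (hcomp LR LR' lhs) (vcomp rhs) u ul ur).
exists (@MkSpanHom _ _ _ _ _ (hcomp LR LR' lhs) (vcomp rhs) v legs_l legs_r).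
split; [exact u1 | split; [exact u2 | exact Hiso]].
Qed.
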